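(* If an online minimization problem $S$ is solved by a $c$-competitive (in expectation) randomized online algorithm $A$ using $s$ bits of memory, then there is a $c$-competitive (in expectation) pure quantum online algorithm $Q$ that solves $S$ using at most $s+1$ qubits.
   Context: An online minimization problem has inputs $I=(x_1,\dots,x_n)$, outputs $(y_1,\dots,y_n)$ and a positive cost function; an online algorithm produces $y_i$ from $x_1,\dots,x_i$ only. A randomized online algorithm additionally reads a tape of independent uniformly random bits; it is $c$-competitive in expectation if there is $\alpha\ge 0$ with $\mathbb{E}[cost]\le c\cdot cost(Opt(I))+\alpha$ for every input $I$, $Opt$ an optimal offline algorithm. A quantum online algorithm may have classical and quantum memory, applies quantum operations and may measure at any time; it is pure if it has no classical memory. Memory usage counts bits (qubits) stored while processing any input. *)

(* Defs.v *)
From HB Require Import structures.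
From mathcomp Require Import all_boot all_order all_algebra.
From mathcomp Require Import sesquilinear spectral.
From mathcomp Require Import complex.
From mathcomp Require Import all_classical all_reals all_analysis.

Set Implicit Arguments.
Unset Strict Implicit.
Unset Printing Implicit Defensive.

Import Order.TTheory GRing.Theory Num.Theory.
Import numFieldNormedType.Exports.

Local Open Scope classical_set_scope.
Local Open Scope ring_scope.
Local Open Scope sesquilinear_scope.

(* Requests have type [X] and answers type [Y].  [Opt] is an optimal offline
   algorithm.  Inputs may be restricted to a subset of all sequences, and every
   input has its own set of feasible outputs; take [inputs := setT] and
   [feasible I := [set O | size O = size I]] for the unrestricted case. *)
Record online_min_problem (R : realType) (X Y : Type) := OnlineMinProblem {
  inputs : set (seq X);
  feasible : seq X -> set (seq Y);
  cost : seq X -> seq Y -> R;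
  Opt : seq X -> seq Y;
  feasible_size : forall I O, inputs I -> feasible I O -> size O = size I;
  cost_gt0 : forall I O, inputs I -> feasible I O -> 0 < cost I O;
  Opt_feasible : forall I, inputs I -> feasible I (Opt I);
  Opt_min : forall I O, inputs I -> feasible I O -> cost I (Opt I) <= cost I O
}.

Record random_tape d (T : measurableType d) (R : realType) (P : probability T R)
    := RandomTape {
  tape :> nat -> T -> bool;
  tape_measurable : forall i, measurable_fun [set: T] (tape i);
  tape_uniform : forall i v, P (tape i @^-1` [set v]) = (2^-1)%:E;
  tape_independent : forall (J : seq nat) (A : nat -> set bool), uniq J ->
    P (\bigcap_(i in [set` J]) (tape i @^-1` A i)) =
    (\prod_(i <- J) P (tape i @^-1` A i))%E
}.

(* On the current request [x] the algorithm performs moves.  A move reads the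
   next [rread x m] bits of the tape and, depending on them, on [x] and on the
   memory contents [m], rewrites the memory and either goes on working on [x]
   ([None]) or answers it ([Some y]) and turns to the next request.  The number
   of moves per request is unbounded, and nothing is kept from one move to the
   next except the [rbits] bits of memory and the position on the tape. *)
Record randomized_alg (X Y : Type) := RandomizedAlg {
  rbits : nat;
  rinit : rbits.-tuple bool;
  rread : X -> rbits.-tuple bool -> nat;
  rmove : X -> rbits.-tuple bool -> seq bool -> rbits.-tuple bool * option Y
}.

(* [None] if more than [N] moves are needed. *)
Fixpoint rrun (X Y : Type) (A : randomized_alg X Y) (N : nat) (I : seq X)
    (psi : nat -> bool) (m : (rbits A).-tuple bool) : option (seq Y) :=
  match I, N with
  | [::], _ => Some [::]
  | _ :: _, 0%N => None
  | x :: I', N'.+1 =>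
      let k := rread x m in
      let psi' := fun i => psi (k + i)%N in
      match rmove x m (mkseq psi k) with
      | (m', None) => rrun N' I psi' m'
      | (m', Some y) => omap (cons y) (rrun N' I' psi' m')
      end
  end.

Definition rhalts (X Y : Type) (A : randomized_alg X Y) (I : seq X)
    (psi : nat -> bool) (O : seq Y) : Prop :=
  exists N, rrun N I psi (rinit A) = Some O.

(* The output on a given tape; the default value [[::]] is irrelevant for
   algorithms that halt almost surely. *)
Definition routput (X Y : Type) (A : randomized_alg X Y) (I : seq X)
    (psi : nat -> bool) : seq Y :=
  match pselect (exists O, rhalts A I psi O) with
  | left ex => projT1 (cid ex)
  | right _ => [::]
  end.

Definition rsolves d (T : measurableType d) (R : realType)
    (P : probability T R) (b : random_tape P) (X Y : Type)
    (S : online_min_problem R X Y) (A : randomized_alg X Y) : Prop :=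
  forall I, inputs S I ->
    {ae P, forall w, exists2 O, rhalts A I (b ^~ w) O & feasible S I O}.

Definition rcompetitive d (T : measurableType d) (R : realType)
    (P : probability T R) (b : random_tape P) (X Y : Type)
    (S : online_min_problem R X Y) (A : randomized_alg X Y) (c : R) : Prop :=
  exists2 alpha : R, 0 <= alpha & forall I, inputs S I ->
    ('E_P[fun w => cost S I (routput A I (b ^~ w))]
       <= (c * cost S I (Opt S I) + alpha)%:E)%E.

(* As above, with [cbits] bits of classical and [qbits] qubits of quantum
   memory.  A move applies to the qubits a quantum operation with measurement
   outcomes ['I_(qout x u)], given by Kraus operators; the outcome determines
   the new classical memory and whether to go on ([None]) or to answer.
   [qnext] need not be injective in the outcome, so this covers all quantum
   operations with finitely many Kraus operators per classical outcome, in
   particular unitaries, projective measurements and channels. *)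
Record quantum_alg (R : realType) (X Y : Type) := QuantumAlg {
  cbits : nat;
  qbits : nat;
  cinit : cbits.-tuple bool;
  qinit : 'cV[R[i]]_(2 ^ qbits);
  qout : X -> cbits.-tuple bool -> nat;
  qkraus : forall (x : X) (u : cbits.-tuple bool),
    'I_(qout x u) -> 'M[R[i]]_(2 ^ qbits);
  qnext : forall (x : X) (u : cbits.-tuple bool),
    'I_(qout x u) -> cbits.-tuple bool * option Y;
  qinit_unit : qinit ^t* *m qinit = 1%:M;
  qkraus_complete : forall x u,
    \sum_(o < qout x u) (qkraus o) ^t* *m qkraus o = 1%:M
}.

Definition pure (R : realType) (X Y : Type) (Q : quantum_alg R X Y) : Prop :=
  cbits Q = 0%N.

(* The contribution to the expectation of [f] (output) of the computations that
   answer all of [I] in exactly [N] moves, from classical memory [u] and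
   unnormalized state vector [v]: the squared norm of the vector obtained by
   applying the Kraus operators of a sequence of outcomes to the initial state
   is the probability of that sequence (Born rule). *)
Fixpoint qrun (R : realType) (X Y : Type) (Q : quantum_alg R X Y) (N : nat)
    (I : seq X) (f : seq Y -> R) (u : (cbits Q).-tuple bool)
    (v : 'cV[R[i]]_(2 ^ qbits Q)) : R :=
  match I, N with
  | [::], 0%N => complex.Re ((v ^t* *m v) 0 0) * f [::]
  | x :: I', N'.+1 =>
      \sum_(o < qout x u)
        match qnext o with
        | (u', None) => qrun N' I f u' (qkraus o *m v)
        | (u', Some y) => qrun N' I' (fun O => f (y :: O)) u' (qkraus o *m v)
        end
  | _, _ => 0
  end.

(* A series of nonnegative terms, hence convergent in [\bar R], whenever [f] is
   nonnegative on the outputs of positive probability. *)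
Definition qexpectation (R : realType) (X Y : Type) (Q : quantum_alg R X Y)
    (I : seq X) (f : seq Y -> R) : \bar R :=
  (\sum_(0 <= N <oo) (qrun N I f (cinit Q) (qinit Q))%:E)%E.

Definition qsolves (R : realType) (X Y : Type) (S : online_min_problem R X Y)
    (Q : quantum_alg R X Y) : Prop :=
  forall I, inputs S I -> qexpectation Q I \1_(feasible S I) = 1%E.

Definition qcompetitive (R : realType) (X Y : Type)
    (S : online_min_problem R X Y) (Q : quantum_alg R X Y) (c : R) : Prop :=
  exists2 alpha : R, 0 <= alpha & forall I, inputs S I ->
    (qexpectation Q I (cost S I) <= (c * cost S I (Opt S I) + alpha)%:E)%E.

(* Main.v *)
(* A coin toss is a measurement whose outcome is forgotten.  Store the memory
   contents m of the randomized algorithm as the basis state |m>, and replace a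
   move that reads k bits by the measurement with one Kraus operator
   2^(-k/2) |m'><m| for every m and every string of k bits, where m' is the new
   memory contents.  The vector reached along a given string of n tape bits is
   then 2^(-n/2) |m'>, whose squared norm is the probability of that string; so
   all expectations agree, and s qubits suffice. *)
Require Import Defs.
From mathcomp Require Import all_boot all_order all_algebra.
From mathcomp Require Import sesquilinear spectral complex.
From mathcomp Require Import all_classical all_reals all_analysis.
From mathcomp Require Import measurable_realfun.

Set Implicit Arguments.
Unset Strict Implicit.
Unset Printing Implicit Defensive.

Import Order.TTheory GRing.Theory Num.Theory.

Local Open Scope classical_set_scope.
Local Open Scope ring_scope.
Local Open Scope sesquilinear_scope.

(** * Vanishing and additivity of quantum runs *)

Lemma qrun0 (R : realType) (X Y : Type) (Q : quantum_alg R X Y) N I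
    (f : seq Y -> R) u : qrun N I f u (0 : 'cV_(2 ^ qbits Q)) = 0.
Proof.
elim: N I f u => [|N IH] [|x I] f u //=; first by rewrite mulmx0 mxE mul0r.
rewrite big1 // => o _; rewrite mulmx0.
by case: (qnext o) => u' [y|]; rewrite IH.
Qed.

(** Valid for functions of either sign; it later allows [f] to be exchanged for its absolute
    value. *)
Lemma qrunD (R : realType) (X Y : Type) (Q : quantum_alg R X Y) N I
    (f g : seq Y -> R) u (v : 'cV_(2 ^ qbits Q)) :
  qrun N I (fun O => f O + g O) u v = qrun N I f u v + qrun N I g u v.
Proof.
elim: N I f g u v => [|N IH] [|x I] f g u v //=; rewrite ?addr0 ?mulrDr//.
rewrite -big_split; apply: eq_bigr => o _.
by case: (qnext o) => u' [y|]; rewrite IH.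
Qed.

(** * Basis states and amplitudes *)

Lemma card_bits s : #|{: s.-tuple bool}| = (2 ^ s)%N.
Proof. by rewrite card_tuple card_bool. Qed.

Definition code s (m : s.-tuple bool) : 'I_(2 ^ s) :=
  cast_ord (card_bits s) (enum_rank m).

Lemma code_inj s : injective (@code s).
Proof. by move=> m m' /cast_ord_inj/enum_rank_inj. Qed.

Definition ket (R : realType) s (m : s.-tuple bool) : 'cV[R[i]]_(2 ^ s) :=
  delta_mx (code m) 0.

Lemma sum_code_delta (R : realType) s :
  \sum_(m : s.-tuple bool) delta_mx (code m) (code m) =
  1%:M :> 'M[R[i]]_(2 ^ s).
Proof.
rewrite mx1_sum_delta (reindex (cast_ord (card_bits s))) /=; last first.
  exists (cast_ord (esym (card_bits s))) => i _.
    by rewrite cast_ordK.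
  by rewrite cast_ordKV.
rewrite [RHS](reindex (@enum_rank _)) //=.
by exists enum_val => i _; rewrite (enum_rankK, enum_valK).
Qed.

(** The amplitude of one fair bit: the Born rule squares it to 1/2. *)
Definition bit_amplitude (R : realType) : R[i] := (Num.sqrt (2^-1))%:C%C.

Lemma conj_bit_amplitude (R : realType) k :
  Num.conj (bit_amplitude R ^+ k) = bit_amplitude R ^+ k.
Proof. by rewrite rmorphXn /= [Num.conj _]conjc_real. Qed.

Lemma sqr_bit_amplitude (R : realType) k :
  bit_amplitude R ^+ k * bit_amplitude R ^+ k = ((2^-1) ^+ k)%:C%C.
Proof.
by rewrite -exprMn -rmorphM /= -expr2 sqr_sqrtr ?invr_ge0 ?ler0n// rmorphXn.
Qed.

(** The adjoint of a real matrix is its transpose, so only the amplitude is squared and becomes a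
    probability. *)
Lemma amplitude_dagger (R : realType) m n k (B : 'M[R[i]]_(m, n)) :
  (forall i j, Num.conj (B i j) = B i j) ->
  (bit_amplitude R ^+ k *: B) ^t* *m (bit_amplitude R ^+ k *: B) =
  ((2^-1) ^+ k)%:C%C *: (B^T *m B).
Proof.
move=> conjB; have -> : (bit_amplitude R ^+ k *: B) ^t* =
    bit_amplitude R ^+ k *: B^T.
  by apply/matrixP => i j; rewrite !mxE rmorphM /= conjB conj_bit_amplitude.
by rewrite -scalemxAl -scalemxAr scalerA sqr_bit_amplitude.
Qed.

Lemma conj_delta (R : realType) m n i0 j0 i j :
  Num.conj ((delta_mx i0 j0 : 'M[R[i]]_(m, n)) i j) = delta_mx i0 j0 i j.
Proof. by rewrite mxE rmorph_nat. Qed.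

(** * The quantum algorithm *)

(* The bits read in a move become part of the measurement outcome. *)
Definition outcome (X Y : Type) (A : randomized_alg X Y) (x : X) : finType :=
  {m : (rbits A).-tuple bool & (rread x m).-tuple bool}.

Lemma sum_outcome (V : nmodType) (X Y : Type) (A : randomized_alg X Y) (x : X)
    (F : outcome A x -> V) :
  \sum_p F p = \sum_m \sum_(β : (rread x m).-tuple bool) F (existT _ m β).
Proof. by rewrite sig_big_dep; apply: eq_bigr => -[]. Qed.

Definition outcome_kraus (R : realType) (X Y : Type) (A : randomized_alg X Y)
    (x : X) (p : outcome A x) : 'M[R[i]]_(2 ^ rbits A) :=
  bit_amplitude R ^+ rread x (tag p) *:
    delta_mx (code (rmove x (tag p) (tagged p)).1) (code (tag p)).

(** For fixed [m] with k bits read, each of the 2^k strings contributes 2^(-k) |m><m|, whatever the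
    new contents are; the projectors |m><m| sum to the identity. *)
Lemma outcome_kraus_complete (R : realType) (X Y : Type)
    (A : randomized_alg X Y) (x : X) :
  \sum_(p : outcome A x) (outcome_kraus R p) ^t* *m outcome_kraus R p = 1%:M.
Proof.
rewrite -(sum_code_delta R (rbits A)) sum_outcome.
apply: eq_bigr => m _.
under eq_bigr => β _.
  rewrite /outcome_kraus /= amplitude_dagger; last exact: conj_delta.
  rewrite trmx_delta mul_delta_mx; over.
rewrite sumr_const card_tuple card_bool scalerMnl -rmorphMn /=.
by rewrite -[_ *+ _]mulr_natr natrX -exprMn mulVf ?pnatr_eq0// expr1n scale1r.
Qed.

Lemma outcome_kraus_ket (R : realType) (X Y : Type) (A : randomized_alg X Y)
    (x : X) (p : outcome A x) m :
  outcome_kraus R p *m ket R m =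
  if tag p == m then bit_amplitude R ^+ rread x (tag p) *:
    ket R (rmove x (tag p) (tagged p)).1 else 0.
Proof.
rewrite /outcome_kraus /ket -scalemxAl; case: p m => m0 β m /=.
case: eqVneq => [<-|ne]; first by rewrite mul_delta_mx.
by rewrite mul_delta_mx_0 ?scaler0// (inj_eq (@code_inj _)).
Qed.

Lemma ket_unit (R : realType) s (m : s.-tuple bool) :
  (ket R m) ^t* *m ket R m = 1%:M.
Proof.
rewrite /ket trmx_delta map_delta_mx mul_delta_mx.
by apply/matrixP => i j; rewrite !ord1 !mxE.
Qed.

Lemma coined_kraus_complete (R : realType) (X Y : Type)
    (A : randomized_alg X Y) (x : X) (u : 0.-tuple bool) :
  \sum_(o < #|{: outcome A x}|)
    (outcome_kraus R (enum_val o)) ^t* *m outcome_kraus R (enum_val o) = 1%:M.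
Proof.
rewrite -(outcome_kraus_complete R A x).
by rewrite -(@big_enum_val _ _ _ _ predT
  (fun p => (outcome_kraus R p) ^t* *m outcome_kraus R p)).
Qed.

(** The classical memory is the empty tuple; [qnext] only reports the answer, since the Kraus
    operator itself rewrites the memory contents. *)
Definition coined (R : realType) (X Y : Type) (A : randomized_alg X Y) :
    quantum_alg R X Y :=
  @QuantumAlg R X Y 0 (rbits A) [tuple] (ket R (rinit A))
    (fun x _ => #|{: outcome A x}|)
    (fun x _ o => outcome_kraus R (enum_val o))
    (fun x _ o => let p : outcome A x := enum_val o in
       ([tuple], (rmove x (tag p) (tagged p)).2))
    (ket_unit R (rinit A)) (@coined_kraus_complete R X Y A).

(** Only outcomes tagged with the current contents [m] survive, so each state reached is again a
    multiple of a basis state, and a sum over bit strings remains. *)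
Lemma qrun_coined_cons (R : realType) (X Y : Type) (A : randomized_alg X Y)
    N x I (f : seq Y -> R) u z m :
  qrun N.+1 (x :: I) f u (z *: ket R m : 'cV_(2 ^ qbits (coined R A))) =
  \sum_(β : (rread x m).-tuple bool)
    let v : 'cV_(2 ^ qbits (coined R A)) :=
      (z * bit_amplitude R ^+ rread x m) *: ket R (rmove x m β).1 in
    match (rmove x m β).2 with
    | None => qrun N (x :: I) f (cinit (coined R A)) v
    | Some y => qrun N I (fun O => f (y :: O)) (cinit (coined R A)) v
    end.
Proof.
pose F (p : outcome A x) : R :=
  let v : 'cV_(2 ^ qbits (coined R A)) := outcome_kraus R p *m (z *: ket R m) in
  match (rmove x (tag p) (tagged p)).2 with
  | None => qrun N (x :: I) f (cinit (coined R A)) v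
  | Some y => qrun N I (fun O => f (y :: O)) (cinit (coined R A)) v
  end.
transitivity (\sum_(p : outcome A x) F p); first by rewrite big_enum_val.
rewrite sum_outcome (bigD1 m) //= [X in _ + X]big1 ?addr0.
  apply: eq_bigr => β _; rewrite /F /= -scalemxAr.
  have := outcome_kraus_ket R (existT _ m β : outcome A x) m.
  by rewrite /= eqxx => ->; rewrite scalerA.
move=> m0 ne; rewrite big1 // => β _; rewrite /F /= -scalemxAr.
have := outcome_kraus_ket R (existT _ m0 β : outcome A x) m.
rewrite /= (negPf ne) => ->; rewrite scaler0.
by case: (rmove _ _ _).2 => [y|]; rewrite qrun0.
Qed.

Lemma qrun_coined_nil (R : realType) (X Y : Type) (A : randomized_alg X Y)
    (f : seq Y -> R) u k m :
  qrun 0 [::] f u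
    (bit_amplitude R ^+ k *: ket R m : 'cV_(2 ^ qbits (coined R A))) =
  (2^-1) ^+ k * f [::].
Proof.
rewrite /= amplitude_dagger; last exact: conj_delta.
by rewrite trmx_delta mul_delta_mx !mxE mulr1.
Qed.

(** * Runs with an exact number of moves *)

(* As [rrun], but [None] unless the computation takes exactly [N] moves, so that
   the terms of the series [qexpectation] correspond to disjoint events. *)
Fixpoint erun (X Y : Type) (A : randomized_alg X Y) (N : nat) (I : seq X)
    (psi : nat -> bool) (m : (rbits A).-tuple bool) : option (seq Y) :=
  match I, N with
  | [::], 0%N => Some [::]
  | x :: I', N'.+1 =>
      let k := rread x m in
      let psi' := fun i => psi (k + i)%N in
      match rmove x m (mkseq psi k) with
      | (m', None) => erun N' I psi' m'
      | (m', Some y) => omap (cons y) (erun N' I' psi' m')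
      end
  | _, _ => None
  end.

Lemma rrun_erun (X Y : Type) (A : randomized_alg X Y) N I psi
    (m : (rbits A).-tuple bool) O :
  rrun N I psi m = Some O <-> exists2 n, (n <= N)%N & erun n I psi m = Some O.
Proof.
elim: N I psi m O => [|N IH] [|x I] psi m O /=.
- split=> [e|[n]]; first by exists 0%N.
  by case: n.
- by split=> // -[[|n]].
- split=> [e|[n]]; first by exists 0%N.
  by case: n.
case E: (rmove _ _ _) => [m' [y|]]; last first.
  rewrite IH; split=> -[n len e].
    by exists n.+1; rewrite ?ltnS //= E.
  by case: n len e => [|n] //= len; rewrite E => e; exists n.
split.
  case E1: (rrun _ _ _ _) => [r|] //= [<-].
  have [n len e] := (IH _ _ _ _).1 E1.
  by exists n.+1; rewrite ?ltnS //= E e.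
move=> [[|n]] //= len; rewrite E.
case e: (erun _ _ _ _) => [r|] //= [<-].
by rewrite ((IH _ _ _ r).2 _) //; exists n.
Qed.

(** Tape and memory determine every move, hence also the number of moves; so on each tape at most
    one term of the series is nonzero. *)
Lemma erun_unique (X Y : Type) (A : randomized_alg X Y) N1 N2 I psi
    (m : (rbits A).-tuple bool) O1 O2 :
  erun N1 I psi m = Some O1 -> erun N2 I psi m = Some O2 -> N1 = N2.
Proof.
elim: N1 N2 I psi m O1 O2 => [|N1 IH] [|N2] [|x I] psi m O1 O2 //=.
case: (rmove _ _ _) => [m' [y|]] e1 e2; congr S; last exact: IH e1 e2.
case e1': (erun N1 _ _ _) e1 => [r1|] // _.
case e2': (erun N2 _ _ _) e2 => [r2|] // _.
exact: IH e1' e2'.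
Qed.

Lemma rhalts_erun (X Y : Type) (A : randomized_alg X Y) I psi O :
  rhalts A I psi O <-> exists n, erun n I psi (rinit A) = Some O.
Proof.
split=> [[N /rrun_erun[n _ e]]|[n e]]; first by exists n.
by exists n; apply/rrun_erun; exists n.
Qed.

Lemma routput_erun (X Y : Type) (A : randomized_alg X Y) I psi N O :
  erun N I psi (rinit A) = Some O -> routput A I psi = O.
Proof.
move=> e; rewrite /routput; case: pselect => [ex|[]]; last first.
  by exists O; apply/rhalts_erun; exists N.
case: (cid ex) => O' /= /rhalts_erun[N' e'].
by move: (e'); rewrite (erun_unique e' e) e => -[].
Qed.

Lemma routput_default (X Y : Type) (A : randomized_alg X Y) I psi :
  (forall N, erun N I psi (rinit A) = None) -> routput A I psi = [::].
Proof.
move=> none; rewrite /routput; case: pselect => // ex; exfalso.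
by case: ex => O /rhalts_erun[n]; rewrite none.
Qed.

(** * Cylinder events of the tape *)

Definition tape_from d (T : measurableType d) (R : realType)
    (P : probability T R) (b : random_tape P) (n : nat) (w : T) : nat -> bool :=
  fun i => b (n + i)%N w.

(** A cylinder event, the classical counterpart of a sequence of measurement outcomes. *)
Definition tape_window d (T : measurableType d) (R : realType)
    (P : probability T R) (b : random_tape P) (n : nat) (s : seq bool) :
    set T :=
  [set w | mkseq (tape_from b n w) (size s) = s].

(** An intersection of single-bit events is the form to which [tape_independent] applies. *)
Lemma tape_windowE d (T : measurableType d) (R : realType)
    (P : probability T R) (b : random_tape P) n s :
  tape_window b n s =
  \bigcap_(i in [set` iota n (size s)]) (b i @^-1` [set nth false s (i - n)%N]).
Proof.
apply/seteqP; split=> w /=.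
  move=> e i /=; rewrite mem_iota => /andP[lni lti].
  by rewrite -[in RHS]e nth_mkseq ?ltn_subLR // /tape_from subnKC.
move=> h; apply: (@eq_from_nth _ false); rewrite size_mkseq // => i lti.
rewrite nth_mkseq // [LHS](h (n + i)%N) ?addKn //=.
by rewrite mem_iota leq_addr ltn_add2l.
Qed.

Lemma measurable_tape_bit d (T : measurableType d) (R : realType)
    (P : probability T R) (b : random_tape P) i (B : set bool) :
  measurable (b i @^-1` B).
Proof.
by rewrite -[X in measurable X]setTI; apply: (tape_measurable b i).
Qed.

Lemma measurable_tape_window d (T : measurableType d) (R : realType)
    (P : probability T R) (b : random_tape P) n s :
  measurable (tape_window b n s).
Proof.
by rewrite tape_windowE; apply: bigcap_measurableType => i _;
  exact: measurable_tape_bit.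
Qed.

Lemma tape_window_prob d (T : measurableType d) (R : realType)
    (P : probability T R) (b : random_tape P) n s :
  P (tape_window b n s) = ((2^-1) ^+ size s)%:E.
Proof.
rewrite tape_windowE (tape_independent b (fun i => [set nth false s (i - n)%N]))
  ?iota_uniq//.
under eq_bigr do rewrite tape_uniform.
by rewrite prodEFin big_const_seq count_predT size_iota -Monoid.iteropE.
Qed.

Lemma tape_window_cat d (T : measurableType d) (R : realType)
    (P : probability T R) (b : random_tape P) n s t :
  tape_window b n (s ++ t) = tape_window b n s `&` tape_window b (n + size s) t.
Proof.
have E w : mkseq (tape_from b n w) (size (s ++ t)) =
    mkseq (tape_from b n w) (size s) ++
    mkseq (tape_from b (n + size s) w) (size t).
  rewrite size_cat /mkseq iotaD map_cat add0n -[X in iota X (size t)]addn0.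
  rewrite iotaDl -map_comp; congr (_ ++ _); apply: eq_map => i /=.
  by rewrite /tape_from addnA.
apply/seteqP; split=> w; rewrite /tape_window /= E.
  move/eqP; rewrite eqseq_cat ?size_mkseq // => /andP[/eqP ? /eqP ?].
  by split.
by move=> [-> ->].
Qed.

Lemma tape_window_cover d (T : measurableType d) (R : realType)
    (P : probability T R) (b : random_tape P) n k :
  \big[setU/set0]_(s <- enum {: k.-tuple bool}) tape_window b n s = setT.
Proof.
rewrite -bigcup_seq; apply/seteqP; split=> w //= _.
exists [tuple of mkseq (tape_from b n w) k]; first by rewrite /= mem_enum.
by rewrite /tape_window /= size_mkseq.
Qed.

(** * Measurability and integrals of runs *)

Lemma erun_cons_window d (T : measurableType d) (R : realType)
    (P : probability T R) (b : random_tape P) (X Y : Type)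
    (A : randomized_alg X Y) N x I n (m : (rbits A).-tuple bool)
    (s : (rread x m).-tuple bool) w :
  tape_window b n s w ->
  erun N.+1 (x :: I) (tape_from b n w) m =
  let psi := tape_from b (n + rread x m) w in
  match (rmove x m s).2 with
  | None => erun N (x :: I) psi (rmove x m s).1
  | Some y => omap (cons y) (erun N I psi (rmove x m s).1)
  end.
Proof.
rewrite /tape_window /= size_tuple => ->.
have -> : (fun i => tape_from b n w (rread x m + i)%N) =
    tape_from b (n + rread x m) w.
  by apply/funext => i; rewrite /tape_from addnA.
by case: (rmove x m s) => m' [].
Qed.

Lemma measurable_cst_set d (T : measurableType d) (Q : Prop) :
  measurable [set _ : T | Q].
Proof.
have [q|q] := pselect Q.
  by rewrite (_ : [set _ | _] = setT) //; apply/seteqP; split.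
by rewrite (_ : [set _ | _] = set0) //; apply/seteqP; split.
Qed.

(** A run of [N] moves inspects finitely many bits: by induction the event is a finite union of
    cylinders, each cut down by an event of a shorter run. Hence [C] may be any set of results. *)
Lemma measurable_erun d (T : measurableType d) (R : realType)
    (P : probability T R) (b : random_tape P) (X Y : Type)
    (A : randomized_alg X Y) N I n (m : (rbits A).-tuple bool)
    (C : set (option (seq Y))) :
  measurable [set w | C (erun N I (tape_from b n w) m)].
Proof.
elim: N I n m C => [|N IH] [|x I] n m C;
  [exact: (measurable_cst_set _ (C _)).. | ].
rewrite -[X in measurable X]setTI -(tape_window_cover b n (rread x m)).
rewrite big_distrl /=; apply: bigsetU_measurable => s _.
pose D := match (rmove x m s).2 with
  | None => [set w | C (erun N (x :: I) (tape_from b (n + rread x m) w)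
                         (rmove x m s).1)]
  | Some y => [set w | (C \o omap (cons y)) (erun N I
                 (tape_from b (n + rread x m) w) (rmove x m s).1)]
  end.
rewrite (_ : _ `&` _ = tape_window b n s `&` D).
  apply: measurableI; first exact: measurable_tape_window.
  by rewrite /D; case: (rmove x m s).2 => [y|]; exact: IH.
have DE w : tape_window b n s w ->
    [set w | C (erun N.+1 (x :: I) (tape_from b n w) m)] w = D w.
  move=> Ww; rewrite /D /mkset (erun_cons_window N I Ww).
  by case: (rmove x m s).2.
apply/seteqP; split=> w [Ww Cw]; split=> //; first by rewrite -DE.
by rewrite DE.
Qed.

Lemma measurable_fun_erun d (T : measurableType d) (R : realType)
    (P : probability T R) (b : random_tape P) (X Y : Type)
    (A : randomized_alg X Y) N I n (m : (rbits A).-tuple bool)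
    (D : set T) d' (U : sigmaRingType d') (g : option (seq Y) -> U) :
  measurable_fun D (fun w => g (erun N I (tape_from b n w) m)).
Proof.
move=> mD B _; apply: measurableI => //.
exact: (measurable_erun b N I n m (g @^-1` B)).
Qed.

(** The word [s] of bits already read is there for the induction: the cylinder of [s] corresponds to
    the amplitude 2^(-|s|/2), and a move splits the cylinder by the next [k] bits just as the
    measurement splits the state. *)
Lemma integral_erun d (T : measurableType d) (R : realType)
    (P : probability T R) (b : random_tape P) (X Y : Type)
    (A : randomized_alg X Y) N I (f : seq Y -> R) (s : seq bool)
    (m : (rbits A).-tuple bool) :
  (forall O, 0 <= f O) ->
  (\int[P]_(w in tape_window b 0 s)
     (oapp f 0 (erun N I (tape_from b (size s) w) m))%:E)%E =
  (qrun N I f (cinit (coined R A)) (bit_amplitude R ^+ size s *: ket R m))%:E.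
Proof.
elim: N I f s m => [|N IH] [|x I] f s m f0.
- under eq_integral do rewrite /=.
  rewrite integral_cst; last exact: measurable_tape_window.
  (* The integrand is the constant [f [::]], and the probability of the cylinder is the Born
     weight. *)
  by rewrite qrun_coined_nil mulrC EFinM -(tape_window_prob b 0 s).
- by rewrite /= integral0.
- by rewrite /= integral0.
pose k := rread x m.
pose F (t : k.-tuple bool) := tape_window b 0 (s ++ t).
have UF : tape_window b 0 s = \big[setU/set0]_(t <- enum {: k.-tuple bool}) F t.
  rewrite -[LHS]setIT -(tape_window_cover b (size s) k) big_distrr /=.
  by apply: eq_bigr => t _; rewrite /F tape_window_cat.
rewrite UF ge0_integral_bigsetU -?UF; last 5 first.
- by move=> t; exact: measurable_tape_window.
- exact: enum_uniq.
(* Disjointness: on a common tape both words equal the [k] bits that follow [s]. *)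
- move=> t t' _ _ [w []]; rewrite /F !tape_window_cat => -[_ /=].
  rewrite /tape_window /= !size_tuple => e [_ e']; apply: val_inj => /=.
  by rewrite -e -e'.
- exact: (measurable_fun_erun b N.+1 (x :: I) _ m (fun o => (oapp f 0 o)%:E)).
- by move=> w _; rewrite lee_fin; case: erun => //=.
rewrite qrun_coined_cons -sumEFin big_enum; apply: eq_bigr => t _.
rewrite -exprD.
pose st := s ++ t.
have size_st : size st = (size s + k)%N by rewrite size_cat size_tuple.
have onF w : F t w -> erun N.+1 (x :: I) (tape_from b (size s) w) m =
    let psi := tape_from b (size st) w in
    match (rmove x m t).2 with
    | None => erun N (x :: I) psi (rmove x m t).1
    | Some y => omap (cons y) (erun N I psi (rmove x m t).1)
    end.
  rewrite /F tape_window_cat size_st => -[_]; exact: erun_cons_window.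
move: onF; rewrite -/k -size_st.
(* After an answer [y] the induction hypothesis is used for [f] precomposed with [cons y]. *)
case: (rmove x m t).2 => [y|] onF; rewrite -IH //;
  apply: eq_integral => w /set_mem/onF -> //=.
by case: erun.
Qed.

Lemma qrun_coinedE d (T : measurableType d) (R : realType)
    (P : probability T R) (b : random_tape P) (X Y : Type)
    (A : randomized_alg X Y) N I (f : seq Y -> R) :
  (forall O, 0 <= f O) ->
  (qrun N I f (cinit (coined R A)) (qinit (coined R A)))%:E =
  (\int[P]_w (oapp f 0 (erun N I (b ^~ w) (rinit A)))%:E)%E.
Proof.
move=> f0; have := integral_erun b N I [::] (rinit A) f0.
rewrite expr0 scale1r => <-.
by have -> : tape_window b 0 [::] = setT by apply/seteqP; split.
Qed.

(** * Expectations of the output *)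

(** Although [routput] is defined by choice, the preimage decomposes countably: either some exact
    run halts with a suitable result, or none does and the default [[::]] decides. *)
Lemma measurable_fun_routput d (T : measurableType d) (R : realType)
    (P : probability T R) (b : random_tape P) (X Y : Type)
    (A : randomized_alg X Y) I d' (U : sigmaRingType d') (g : seq Y -> U) :
  measurable_fun [set: T] (fun w => g (routput A I (b ^~ w))).
Proof.
move=> _ B _; rewrite setTI.
pose ans N := [set w : T | exists2 O, B (g O) &
  erun N I (tape_from b 0 w) (rinit A) = Some O].
pose none N := [set w : T | erun N I (tape_from b 0 w) (rinit A) = None].
rewrite (_ : _ @^-1` B = \bigcup_N ans N `|`
    (\bigcap_N none N `&` [set w | B (g [::])])).
  apply: measurableU.
    apply: bigcupT_measurable => N.
    exact: (measurable_erun b N I 0 (rinit A)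
      [set o | exists2 O, B (g O) & o = Some O]).
  apply: measurableI; last exact: measurable_cst_set.
  apply: bigcap_measurableType => N _.
  exact: (measurable_erun b N I 0 (rinit A) [set None]).
apply/seteqP; split=> w /=.
  have [h|h] := pselect (exists N, erun N I (b ^~ w) (rinit A) <> None).
    case: h => N; case e: erun => [r|] // _; rewrite (routput_erun e) => Br.
    by left; exists N => //; exists r.
  have allN N : erun N I (b ^~ w) (rinit A) = None.
    by apply: contrapT => nN; apply: h; exists N.
  by rewrite routput_default // => Bd; right; split=> // N _; exact: allN.
case=> [[N _ [r Br e]]|[allN Bd]]; first by rewrite (routput_erun e).
by rewrite routput_default // => N; exact: allN.
Qed.

Lemma nneseries_erun (R : realType) (X Y : Type) (A : randomized_alg X Y)
    I psi O (f : seq Y -> R) :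
  (forall O, 0 <= f O) -> rhalts A I psi O ->
  (\sum_(0 <= N <oo) (oapp f 0 (erun N I psi (rinit A)))%:E =
   (f (routput A I psi))%:E)%E.
Proof.
move=> f0 /rhalts_erun[n e].
rewrite (nneseriesD1 (n := n)) //; last first.
  by move=> k _; rewrite lee_fin; case: erun => /=.
rewrite e (routput_erun e) eseries0 ?adde0 // => k _ /= nk.
case e': erun => [r|] //=.
by rewrite (erun_unique e' e) eqxx in nk.
Qed.

(** Nonnegativity permits exchanging series and integral; the integrands then agree on every tape
    where [A] halts, hence almost everywhere. *)
Lemma qexpectation_coined_ge0 d (T : measurableType d) (R : realType)
    (P : probability T R) (b : random_tape P) (X Y : Type)
    (A : randomized_alg X Y) I (f : seq Y -> R) :
  (forall O, 0 <= f O) ->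
  {ae P, forall w, exists O, rhalts A I (b ^~ w) O} ->
  qexpectation (coined R A) I f = 'E_P[fun w => f (routput A I (b ^~ w))]%E.
Proof.
move=> f0 halts; rewrite /qexpectation expectation.unlock.
under eq_eseriesr do rewrite (qrun_coinedE b A _ I f0).
pose g N w := (oapp f 0 (erun N I (b ^~ w) (rinit A)))%:E.
have mg N : measurable_fun [set: T] (g N).
  exact: (measurable_fun_erun b N I 0 (rinit A) (fun o => (oapp f 0 o)%:E)).
have g0 N w : (0 <= g N w)%E by rewrite lee_fin; case: erun => /=.
rewrite -integral_nneseries //; last by move=> N w _; exact: g0.
apply: ae_eq_integral => //.
- by apply: (ge0_emeasurable_sum (h := g) (P := predT)).
- exact: (measurable_fun_routput b A I (fun O => (f O)%:E)).
- by apply: filterS halts => w [r /(nneseries_erun f0) e] _.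
Qed.

(** A cost is known to be positive only on feasible outputs, so the sign of [f] is assumed only on
    almost sure outputs. Both sides are unchanged when [f] is replaced by its absolute value. *)
Lemma qexpectation_coined d (T : measurableType d) (R : realType)
    (P : probability T R) (b : random_tape P) (X Y : Type)
    (A : randomized_alg X Y) I (f : seq Y -> R) :
  {ae P, forall w, exists2 O, rhalts A I (b ^~ w) O & 0 <= f O} ->
  qexpectation (coined R A) I f = 'E_P[fun w => f (routput A I (b ^~ w))]%E.
Proof.
move=> halts.
(* [f] may be negative on answers of probability zero. *)
have qrun_norm N : qrun N I f (cinit (coined R A)) (qinit (coined R A)) =
    qrun N I (fun O => `|f O|) (cinit (coined R A)) (qinit (coined R A)).
  (* The defect [h] is nonnegative everywhere, so its [qrun] is an integral; that integral is 0
     because [h] vanishes on almost sure outputs. *)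
  pose h O := `|f O| - f O.
  have h0 O : 0 <= h O by rewrite subr_ge0 ler_norm.
  have -> : (fun O => `|f O|) = (fun O => f O + h O).
    by apply/funext => O; rewrite /h addrC subrK.
  rewrite qrunD -[LHS]addr0; congr (_ + _); apply: EFin_inj.
  rewrite (qrun_coinedE b) //.
  transitivity (\int[P]_(w in [set: T]) (0 : \bar R))%E.
    by rewrite integral0.
  apply: ae_eq_integral => //.
    exact: (measurable_fun_erun b N I 0 (rinit A) (fun o => (oapp h 0 o)%:E)).
  apply: filterS halts => w [r /rhalts_erun[n e] fr] _.
  (* A run of exactly [N] moves, if there is one, must return [r], where [f] is nonnegative. *)
  case e': erun => [r'|] //=; move: (e).
  rewrite -(erun_unique e' e) e' => -[->].
  by rewrite /h ger0_norm // subrr.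
rewrite /qexpectation; under eq_eseriesr do rewrite qrun_norm.
rewrite -/(qexpectation (coined R A) I (fun O => `|f O|)).
rewrite (qexpectation_coined_ge0 (b := b)) //; last first.
  by apply: filterS halts => w [r]; exists r.
rewrite expectation.unlock; apply: ae_eq_integral => //.
- exact: (measurable_fun_routput b A I (fun O => `|f O|%:E)).
- exact: (measurable_fun_routput b A I (fun O => (f O)%:E)).
- apply: filterS halts => w [r /rhalts_erun[n e] fr] _.
  by rewrite (routput_erun e) ger0_norm.
Qed.

(** * Solving and competitiveness of the quantum algorithm *)

Theorem theorem9 (R : realType) (d : measure_display) (T : measurableType d)
    (P : probability T R) (b : random_tape P) (X Y : Type)
    (S : online_min_problem R X Y) (c : R) (s : nat) (A : randomized_alg X Y) :
  rsolves b S A -> rcompetitive b S A c -> rbits A = s ->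
  exists Q : quantum_alg R X Y,
    [/\ pure Q, (qbits Q <= s.+1)%N, qsolves S Q & qcompetitive S Q c].
Proof.
move=> sol [alpha alpha0 comp] <-; exists (coined R A); split=> //.
  move=> I SI; rewrite (qexpectation_coined (b := b)); last first.
    by apply: filterS (sol I SI) => w [r hr _]; exists r.
  rewrite expectation.unlock.
  transitivity (\int[P]_(w in [set: T]) (1 : \bar R))%E; last first.
    by rewrite integral_cst // mul1e; exact: probability_setT.
  apply: ae_eq_integral => //.
    exact: (measurable_fun_routput b A I (fun O => (\1_(feasible S I) O)%:E)).
  apply: filterS (sol I SI) => w [r /rhalts_erun[n e] Fr] _.
  by rewrite (routput_erun e) indicE mem_set.
(* Equal expectations transfer the bound with the same [c] and [alpha]; positive costs of feasible
   outputs supply the sign condition. *)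
exists alpha => // I SI; rewrite (qexpectation_coined (b := b)).
  exact: comp.
apply: filterS (sol I SI) => w [r hr Fr]; exists r => //.
exact/ltW/(cost_gt0 SI Fr).
Qed.
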